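(* Let $\Sigma$ be a finite alphabet with at least two letters, and let $n\ge 2$ and $1\le t_1\le t_2$ be integers with $t_1+t_2\le n$ and $2t_2\ge n-t_1+1$. Let $(L_1,R_1)$ be a partition of $\Sigma$ into two non-empty parts, and for every $i\in\{2,\dots,t_2\}$ let $(L_i,R_i)$ be a partition of $\bigcup_{j=1}^{i-1}L_jR_{i-j}$ into two disjoint, possibly empty, parts. Then $$C=\bigcup_{k=0}^{t_1-1}\ \bigcup_{s=t_1+t_2-k}^{n-k}\ \bigcup_{j=s-t_2}^{t_2}\ \bigcup_{\alpha}\ \bigcup_{i=0}^{\mathrm{par}(\alpha)}L_{\alpha_1}\cdots L_{\alpha_i}\,L_jR_{s-j}\,R_{\alpha_{i+1}}\cdots R_{\alpha_{\mathrm{par}(\alpha)}}\Sigma^{k}\subseteq\Sigma^n,$$ where $\alpha$ ranges over all compositions of $n-k-s$, is a $(t_1,t_2)$-overlap-free code.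
   Context: For sets of words $L,R$, $LR$ denotes the set of all concatenations $lr$ with $l\in L$, $r\in R$; $\Sigma^m$ is the set of all words of length $m$ over $\Sigma$. A composition of a positive integer $m$ is a tuple $\alpha=(\alpha_1,\dots,\alpha_p)$ of positive integers with sum $m$; $\mathrm{par}(\alpha)=p$ is its number of parts; the only composition of $0$ is the empty one, with $\mathrm{par}=0$. A union over an empty index range is empty. Two (not necessarily distinct) words $u,v$ have a $t$-overlap if the prefix of $u$ of length $t$ equals the suffix of $v$ of length $t$, or vice versa. A code $C\subseteq\Sigma^n$ is $(t_1,t_2)$-overlap-free if for all $t_1\le t\le t_2$ no two (not necessarily distinct) codewords have a $t$-overlap. *)

(* Defs.v *)
From mathcomp Require Import all_boot.
From mathcomp Require Import boolp classical_sets.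

Set Implicit Arguments.
Unset Strict Implicit.
Unset Printing Implicit Defensive.

Local Open Scope classical_set_scope.

Section Languages.
Variable T : Type.
Implicit Types (L R : set (seq T)) (m : nat).

(* The set T^m; in particular the alphabet itself, viewed as a set of words, is
   [words 1]. *)
Definition words m : set (seq T) := [set w | size w = m].

Definition cat_lang L R : set (seq T) := [set l ++ r | l in L & r in R].

Definition cat_langs (s : seq (set (seq T))) : set (seq T) :=
  foldr cat_lang [set [::]] s.

(* Either part may be empty. *)
Definition split_in_two (A L R : set (seq T)) : Prop :=
  L `|` R = A /\ L `&` R = set0.

End Languages.

(* The number of parts par(a) is [size a]. *)
Definition compositions (m : nat) : set (seq nat) :=
  [set a | all (leq 1) a /\ sumn a = m].

(* Going through a common word [w] of size [t] makes this false, rather than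
   dependent on truncation, when [u] or [v] has fewer than [t] letters. *)
Definition overlap (T : eqType) (t : nat) (u v : seq T) : Prop :=
  exists w : seq T, size w = t /\
    ((prefix w u /\ suffix w v) \/ (prefix w v /\ suffix w u)).

Definition overlap_free_code (T : eqType) (n t1 t2 : nat)
    (C : set (seq T)) : Prop :=
  C `<=` @words T n /\
  forall t : nat, t1 <= t <= t2 ->
  forall u v : seq T, C u -> C v -> ~ overlap t u v.

(* With 0 < t1, t1 + t2 <= n and n - t1 + 1 <= 2 * t2, none of the natural
   subtractions below truncates, and [L] and [R] are only used at indices
   between 1 and t2. *)
Definition code_of_partitions (T : Type) (n t1 t2 : nat)
    (L R : nat -> set (seq T)) : set (seq T) :=
  \bigcup_(k in [set k : nat | 0 <= k <= t1 - 1])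
  \bigcup_(s in [set s : nat | t1 + t2 - k <= s <= n - k])
  \bigcup_(j in [set j : nat | s - t2 <= j <= t2])
  \bigcup_(a in compositions (n - k - s))
  \bigcup_(i in [set i : nat | 0 <= i <= size a])
    cat_langs (map L (take i a) ++ [:: L j; R (s - j)]
               ++ map R (drop i a) ++ [:: @words T k]).

(* Main.v *)
(** Call the elements of [L_i] and [R_i], [1 <= i <= t2], left and right blocks,
    and write [L^*], [R^*] for the sets of concatenations of left, resp. right,
    blocks. A block is a letter or a left block followed by a right block, so by
    induction every proper prefix of a block is in [L^*] and every proper suffix
    in [R^*]. Hence [L^*] is closed under prefixes and [R^*] under suffixes. A
    shortest nonempty word in both [L^*] and [R^*] would have to be a single left
    block (otherwise drop its first left block) and a single right block
    (otherwise keep only its first right block), which is impossible; so the two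
    sets share only the empty word.

    In a codeword the central factor [L_j R_{s-j}] has length [s > t2]. Therefore
    its prefixes of length at most [t2] lie in [L^*], and once the [k < t1] free
    letters at the end are dropped, its suffixes of length at most [t2] lie in
    [R^*]. A [t]-overlap with [t1 <= t <= t2], shortened by [k] letters, would be
    a nonempty word in both sets. *)

Require Import Defs.
From mathcomp Require Import all_boot.
From mathcomp Require Import boolp classical_sets.
From mathcomp Require Import zify.

Local Open Scope classical_set_scope.

(** Levi's lemma, used throughout to locate a cut relative to a block boundary; [d] is the stretch
    between the two. *)
Lemma cat_eq_cat (T : Type) (p q x y : seq T) : p ++ q = x ++ y ->
  (exists d, x = p ++ d /\ q = d ++ y) \/ (exists d, p = x ++ d /\ y = d ++ q).
Proof.
elim: p x => [|a p IH] [|b x] /=.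
- by move=> ->; left; exists [::].
- by move=> ->; left; exists (b :: x).
- by move=> <-; right; exists (a :: p).
- case=> <- /IH [] [d [-> ->]]; [left|right]; by exists d.
Qed.

Inductive star (T : Type) (P : set (seq T)) : set (seq T) :=
| star_nil : star T P [::]
| star_cons x y : P x -> star T P y -> star T P (x ++ y).

Arguments star {T} P _.
Arguments star_nil {T P}.
Arguments star_cons {T P x y}.

Lemma star_cat (T : Type) (P : set (seq T)) x y :
  star P x -> star P y -> star P (x ++ y).
Proof. by elim=> // a b Pa _ IH /IH; rewrite -catA; apply: star_cons. Qed.

Lemma star1 (T : Type) (P : set (seq T)) x : P x -> star P x.
Proof. by move=> Px; rewrite -(cats0 x); exact: star_cons Px star_nil. Qed.

Lemma starP (T : Type) (P : set (seq T)) w : star P w ->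
  w = [::] \/ exists x y, [/\ w = x ++ y, P x & star P y].
Proof. by case=> [|x y Px sy]; [left|right; exists x, y]. Qed.

Lemma cat_langs_cat (T : Type) (s1 s2 : seq (set (seq T))) (x : seq T) :
  cat_langs (s1 ++ s2) x ->
  exists y z, [/\ x = y ++ z, cat_langs s1 y & cat_langs s2 z].
Proof.
elim: s1 x => [|A s1 IH] x /=; first by exists [::], x.
case=> y Ay [z /IH [z1 [z2 [-> s1z1 s2z2]]] <-].
by exists (y ++ z1), z2; rewrite catA; split=> //; exists y => //; exists z1.
Qed.

Lemma cat_langs1 (T : Type) (A : set (seq T)) x : cat_langs [:: A] x -> A x.
Proof. by move=> /= [y Ay [z -> <-]]; rewrite cats0. Qed.

Section Blocks.
Variables (T : Type) (bl br : set (seq T)).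
Hypothesis bl_neq0 : ~ bl [::].
Hypothesis br_neq0 : ~ br [::].
Hypothesis bl_br_disjoint : forall x, bl x -> ~ br x.
Hypothesis block_split : forall x, bl x \/ br x ->
  size x = 1 \/ exists y z, [/\ x = y ++ z, bl y & br z].

(** Strong induction on length, over left and right blocks together because the cut of [y ++ z] may
    fall in either factor. The condition on [q] keeps the cut proper: a whole right block is never
    in [star bl]. *)
Lemma block_prefix p q : bl (p ++ q) \/ br (p ++ q) -> q <> [::] -> star bl p.
Proof.
have [m] := ubnP (size (p ++ q)); elim: m p q => // m IH p q ltm bpq q0.
case: (block_split _ bpq) => [|[y [z [e bly brz]]]].
  by case: p {ltm bpq} => [|a [|]] //; [move=> _; exact: star_nil|case: q q0].
have y0 : size y != 0 by apply/negP => /nilP y0; apply: bl_neq0; rewrite -y0.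
have z0 : size z != 0 by apply/negP => /nilP z0; apply: br_neq0; rewrite -z0.
move: ltm; rewrite e size_cat => ltm.
case: (cat_eq_cat _ _ _ _ _ e) => [[d [ey eq]]|[d [-> ez]]].
  (* A cut exactly between [y] and [z] leaves no proper prefix of [y], but then [p] is the left
     block [y] itself. *)
  case: d ey eq => [|a d] ey _; first by rewrite cats0 in ey; subst; exact: star1.
  by apply: (IH p (a :: d)) => //; rewrite -ey; [lia|left].
by apply: star_cons => //; apply: (IH d q) => //; rewrite -ez; [lia|right].
Qed.

Lemma block_suffix p q : bl (p ++ q) \/ br (p ++ q) -> p <> [::] -> star br q.
Proof.
have [m] := ubnP (size (p ++ q)); elim: m p q => // m IH p q ltm bpq p0.
case: (block_split _ bpq) => [|[y [z [e bly brz]]]].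
  by case: p p0 {ltm bpq} => [|a [|]] // _; case: q => // _; exact: star_nil.
have y0 : size y != 0 by apply/negP => /nilP y0; apply: bl_neq0; rewrite -y0.
have z0 : size z != 0 by apply/negP => /nilP z0; apply: br_neq0; rewrite -z0.
move: ltm; rewrite e size_cat => ltm.
case: (cat_eq_cat _ _ _ _ _ e) => [[d [ey ->]]|[d [ep ez]]].
  by apply: star_cat (star1 _ _ _ brz); apply: (IH p d) => //; rewrite -ey; [lia|left].
case: d ep ez => [|a d] _ ez; first by rewrite /= in ez; subst; exact: star1.
by apply: (IH (a :: d) q) => //; rewrite -ez; [lia|right].
Qed.

Lemma star_prefix p q : star bl (p ++ q) -> star bl p.
Proof.
move e: (p ++ q) => w sw; elim: sw p e => [|x y blx _ IH] p.
  by case: p => // _; exact: star_nil.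
case/cat_eq_cat => [[d [ex _]]|[d [-> ey]]]; last first.
  by apply: star_cons => //; exact: IH.
case: d ex => [|a d] ex; first by rewrite cats0 in ex; subst; exact: star1.
by apply: (block_prefix p (a :: d)) => //; rewrite -ex; left.
Qed.

Lemma star_suffix p q : star br (p ++ q) -> star br q.
Proof.
move e: (p ++ q) => w sw; elim: sw p e => [|x y brx sy IH] p.
  by case: p => //= ->; exact: star_nil.
case/cat_eq_cat => [[d [ex ->]]|[d [_ ey]]]; last exact: IH (esym ey).
apply: star_cat => //; case: p ex => [|a p] ex.
  by rewrite -[d]/([::] ++ d) -ex; exact: star1.
by apply: (block_suffix (a :: p)) => //; rewrite -ex; right.
Qed.

Lemma star_disjoint x : star bl x -> star br x -> x = [::].
Proof.
have [m] := ubnP (size x); elim: m x => // m IH x ltm sl sr.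
case: (starP _ _ _ sl) => [//|[l [y [ex bll sy]]]].
case: (starP _ _ _ sr) => [//|[r [z [ex' brr sz]]]].
have l0 : size l != 0 by apply/negP => /nilP l0; apply: bl_neq0; rewrite -l0.
have r0 : size r != 0 by apply/negP => /nilP r0; apply: br_neq0; rewrite -r0.
have /nilP y0 : size y == 0.
  apply/eqP; rewrite (IH y) //; first by move: ltm; rewrite ex size_cat; lia.
  by apply: (star_suffix l); rewrite -ex.
(* Otherwise [r], a right block and a prefix of [x], would be shorter than [x] and in both stars,
   hence empty. *)
have /nilP z0 : size z == 0.
  case: (posnP (size z)) => [//|zgt0].
  have r1 : r = [::]; last by rewrite r1 in r0.
  apply: IH; [by move: ltm; rewrite ex' size_cat; lia | | exact: star1].
  by apply: (star_prefix r z); rewrite -ex'.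
case: (bl_br_disjoint l) => //.
by move: bll brr; rewrite y0 z0 !cats0 in ex ex'; rewrite -ex -ex'.
Qed.

(** For the beginning of a codeword: when [p] ends inside [r], the condition on [q] makes the cut of
    this right block proper. *)
Lemma star_block_prefix x r p q : star bl x -> br r -> p ++ q = x ++ r ->
  q <> [::] -> star bl p.
Proof.
move=> sx brr /cat_eq_cat [[d [ex _]] _|[d [-> er]] q0].
  by apply: (star_prefix p d); rewrite -ex.
by apply: star_cat => //; apply: (block_prefix d q) => //; rewrite -er; right.
Qed.

Lemma block_star_suffix l y p q : bl l -> star br y -> p ++ q = l ++ y ->
  p <> [::] -> star br q.
Proof.
move=> bll sy /cat_eq_cat [[d [el ->]] p0|[d [_ ey]] _].
  by apply: star_cat => //; apply: (block_suffix p d) => //; rewrite -el; left.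
by apply: (star_suffix d); rewrite -ey.
Qed.

End Blocks.

(** The index is read off as the length of the word, so a word that is both a left and a right block
    is so at the same index. *)
Definition blocks (T : Type) (m : nat) (L : nat -> set (seq T)) : set (seq T) :=
  [set x | 1 <= size x <= m /\ L (size x) x].

Lemma cat_langs_blocks (T : Type) (m : nat) (L : nat -> set (seq T)) a x :
  (forall i w, 1 <= i <= m -> L i w -> size w = i) ->
  all (leq 1) a -> sumn a <= m -> cat_langs (map L a) x ->
  star (blocks T m L) x /\ size x = sumn a.
Proof.
move=> szL; elim: a x => [|i a IH] x /=; first by move=> _ _ ->; split; first exact: star_nil.
move=> /andP [i1 a1] lem [y Ly [z az <-]].
have [sz szz] := IH _ a1 ltac:(lia) az.
have szy : size y = i by apply: szL Ly; lia.
split; last by rewrite size_cat szy szz.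
by apply: star_cons => //; split; rewrite szy //; lia.
Qed.

Lemma code_of_partitions_decomp (T : Type) (n t1 t2 : nat)
    (L R : nat -> set (seq T)) u :
  1 <= t1 -> t1 + t2 <= n -> n - t1 + 1 <= 2 * t2 ->
  (forall i w, 1 <= i <= t2 -> L i w -> size w = i) ->
  (forall i w, 1 <= i <= t2 -> R i w -> size w = i) ->
  code_of_partitions n t1 t2 L R u ->
  exists x l r y z, [/\ u = x ++ l ++ r ++ y ++ z,
    [/\ star (blocks T t2 L) x, blocks T t2 L l, blocks T t2 R r &
      star (blocks T t2 R) y], size z < t1, t2 < size (l ++ r) & size u = n].
Proof.
move=> t1_gt0 le_n ge_n szL szR [k /= kt1 [s /= sP [j /= jP [a [a1 suma] [i /= _]]]]].
case/cat_langs_cat=> x [lryz [-> Lx]] /=.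
case=> l Ll [lr [r Rr [yz /cat_langs_cat [y [z [-> Ry /cat_langs1 zk]]] <-]] <-].
move: a1 suma; rewrite -{1 2}(cat_take_drop i a) all_cat sumn_cat.
move=> /andP [a1 a2] suma.
(* The parts of [a] sum to [n - k - s <= n - t1 - t2 < t2], by [ge_n], so each of them is an
   admissible block index. *)
have [sx szx] := cat_langs_blocks T t2 L _ _ szL a1 ltac:(lia) Lx.
have [sy szy] := cat_langs_blocks T t2 R _ _ szR a2 ltac:(lia) Ry.
(* From [k < t1] follows [s >= t1 + t2 - k > t2], so [s - t2 <= j <= t2] puts both [j] and [s - j]
   between 1 and [t2]. *)
have szl : size l = j by apply: szL Ll; lia.
have szr : size r = s - j by apply: szR Rr; lia.
have szz : size z = k := zk.
exists x, l, r, y, z; split=> //; rewrite ?size_cat; try lia.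
by split=> //; split; rewrite ?szl ?szr //; lia.
Qed.

Section Overlap.
Variables (T : eqType) (n t1 t2 : nat) (L R : nat -> set (seq T)).
Hypothesis splits1 : split_in_two (@words T 1) (L 1) (R 1).
Hypothesis splits : forall i : nat, 2 <= i <= t2 ->
  split_in_two
    (\bigcup_(j in [set j : nat | 1 <= j <= i - 1]) cat_lang (L j) (R (i - j)))
    (L i) (R i).

Let bl := blocks T t2 L.
Let br := blocks T t2 R.

(** A word at index [i >= 2] has one factor from [L] and one from [R], both at smaller indices, so
    the induction treats the two families at once. *)
Lemma partition_size i w : 1 <= i <= t2 -> L i w \/ R i w -> size w = i.
Proof.
have [m] := ubnP i; elim: m i w => // m IH i w ltm /andP [i1 it2].
move=> iw; have {iw} : (L i `|` R i) w by [].
case: (ltngtP i 1) => [|i2|ei]; [lia| |]; last first.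
  by rewrite ei; case: splits1 => -> _.
case: (splits i) => [|-> _]; first lia.
move=> -[j /= jP [y Ly [z Rz <-]]].
rewrite size_cat (IH j y) ?(IH (i - j) z); [lia|lia|lia|by right|lia|lia|by left].
Qed.

Lemma blocks_disjoint x : bl x -> ~ br x.
Proof.
move=> [szx Lx] [_ Rx].
have [e|ne] := eqVneq (size x) 1.
  case: splits1 => _; rewrite -e => /seteqP [+ _] => /(_ x); exact.
by case: (splits (size x)) => [|_ /seteqP [/(_ x) + _]]; [lia|exact].
Qed.

Lemma blocks_split x : bl x \/ br x ->
  size x = 1 \/ exists y z, [/\ x = y ++ z, bl y & br z].
Proof.
move=> b; have [szx LRx] : 1 <= size x <= t2 /\ (L (size x) `|` R (size x)) x.
  by case: b => -[? ?]; split=> //; [left|right].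
have [e|ne] := eqVneq (size x) 1; [by left|right].
case: (splits (size x)) => [|e _]; first lia.
move: LRx; rewrite e => -[j /= jP [y Ly [z Rz ex]]].
have szy : size y = j by apply: partition_size; [lia|left].
have szz : size z = size x - j by apply: partition_size; [lia|right].
by exists y, z; split=> //; split; rewrite ?szy ?szz //; lia.
Qed.

Lemma bl_nil : ~ bl [::]. Proof. by case. Qed.
Lemma br_nil : ~ br [::]. Proof. by case. Qed.

Hypotheses (t1_gt0 : 1 <= t1) (le_n : t1 + t2 <= n) (ge_n : n - t1 + 1 <= 2 * t2).

Lemma code_of_partitions_no_overlap t u v w :
  t1 <= t <= t2 -> size w = t ->
  code_of_partitions n t1 t2 L R u -> code_of_partitions n t1 t2 L R v ->
  prefix w u -> suffix w v -> False.
Proof.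
move=> tP szw Cu Cv /prefixP [u' eu] /suffixP [v' ev].
have szL i x : 1 <= i <= t2 -> L i x -> size x = i.
  by move=> iP Lx; apply: partition_size => //; left.
have szR i x : 1 <= i <= t2 -> R i x -> size x = i.
  by move=> iP Rx; apply: partition_size => //; right.
have [x [l [r [y [z [eu' [sx bll brr _] _ ltlr _]]]]]] :=
  code_of_partitions_decomp _ _ _ _ _ _ _ t1_gt0 le_n ge_n szL szR Cu.
have [x' [l' [r' [y' [z' [ev' [_ bll' brr' sy'] ltz' ltlr' _]]]]]] :=
  code_of_partitions_decomp _ _ _ _ _ _ _ t1_gt0 le_n ge_n szL szR Cv.
(* Since [size w <= t2 < size (l ++ r)], the prefix [w] of [u] stops before the end of [r]. *)
have slw : star bl w.
  have /cat_eq_cat [[d [ed _]]|[d [ed _]]] :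
      w ++ u' = ((x ++ l) ++ r) ++ (y ++ z) by rewrite -eu eu' -!catA.
    apply: (star_block_prefix _ _ _ bl_nil br_nil blocks_split (x ++ l) r w d) => //.
      by apply: star_cat => //; exact: star1.
    by move=> d0; move: ltlr; rewrite -szw in tP; move/(congr1 size): ed;
      rewrite d0 !size_cat /=; lia.
  by move/(congr1 size): ed; rewrite !size_cat in ltlr *; lia.
(* The free tail [z'] has fewer than [t1] letters, so [w = d ++ z'] with [d] nonempty. *)
have /cat_eq_cat [[d [ed ew]]|[d [_ /(congr1 size)]]] :
    v' ++ w = (x' ++ l' ++ r' ++ y') ++ z' by rewrite -ev ev' -!catA.
  have srd : star br d.
    (* As [d] has at most [t2] letters, fewer than [l' ++ r'], it starts strictly after the
       beginning of [l']. *)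
    have /cat_eq_cat [[f [_ ed']]|[f [_ ef]]] : v' ++ d = x' ++ (l' ++ (r' ++ y')).
      by rewrite -ed.
    move/(congr1 size): ed'; move/(congr1 size): ew; rewrite !size_cat in ltlr' *; lia.
    apply: (block_star_suffix _ _ _ bl_nil br_nil blocks_split l' (r' ++ y') f d) => //.
      exact: star_cons.
    move=> f0; move/(congr1 size): ef; move/(congr1 size): ew.
    by rewrite f0 !size_cat /= in ltlr' *; lia.
  have sld : star bl d.
    by apply: (star_prefix _ _ _ bl_nil br_nil blocks_split d z'); rewrite -ew.
  have d0 := star_disjoint _ _ _ bl_nil br_nil blocks_disjoint blocks_split d sld srd.
  by move/(congr1 size): ew; rewrite d0 /=; lia.
by rewrite size_cat; lia.
Qed.

End Overlap.

Theorem mainTheorem8 (Sigma : finType) (n t1 t2 : nat)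
    (L R : nat -> set (seq Sigma)) :
  2 <= #|Sigma| -> 2 <= n -> 1 <= t1 -> t1 <= t2 ->
  t1 + t2 <= n -> n - t1 + 1 <= 2 * t2 ->
  split_in_two (@words Sigma 1) (L 1) (R 1) -> L 1 !=set0 -> R 1 !=set0 ->
  (forall i : nat, 2 <= i <= t2 ->
     split_in_two
       (\bigcup_(j in [set j : nat | 1 <= j <= i - 1]) cat_lang (L j) (R (i - j)))
       (L i) (R i)) ->
  overlap_free_code n t1 t2 (code_of_partitions n t1 t2 L R).
Proof.
move=> _ _ t1_gt0 _ le_n ge_n splits1 _ _ splits; split=> [u|t tP u v Cu Cv].
  case/code_of_partitions_decomp => //.
  - by move=> i w iP Lw; apply: (partition_size _ _ L R splits1 splits) => //; left.
  - by move=> i w iP Rw; apply: (partition_size _ _ L R splits1 splits) => //; right.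
  by move=> x [l [r [y [z []]]]].
have no_overlap :=
  code_of_partitions_no_overlap _ n t1 t2 L R splits1 splits t1_gt0 le_n ge_n.
by case=> w [szw [[pu sv]|[pv su]]]; [exact: (no_overlap t u v w)|exact: (no_overlap t v u w)].
Qed.
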